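(* The action of $\Xi=\mathcal M/\!\approx$ on $\Omega=\mathcal V/\!\leftrightarrow$ given by $\hat A\,\vec{\circ}\,\bar x:=\overline{A\,\vec{\circ}\,x}$ is well defined; that is, if $A\approx B$ in $\mathcal M$ and $x\leftrightarrow y$ in $\mathcal V$, then $A\,\vec{\circ}\,x\leftrightarrow B\,\vec{\circ}\,y$.
   Context: $\mathcal V=\bigcup_{n\ge1}\mathbb R^n$ (disjoint union, column vectors), $\mathcal M=\bigcup_{m\ge1}\bigcup_{n\ge1}\mathcal M_{m\times n}$ where $\mathcal M_{m\times n}$ is the set of real $m\times n$ matrices. $\mathbf 1_k\in\mathbb R^k$ is the all-ones vector, $J_k:=\frac1k\mathbf 1_{k\times k}$ where $\mathbf 1_{k\times k}$ is the $k\times k$ all-ones matrix, $\otimes$ is the Kronecker product. For $A\in\mathcal M_{m\times n}$, $x\in\mathbb R^r$, $t=\mathrm{lcm}(n,r)$: $A\,\vec{\circ}\,x:=(A\otimes J_{t/n})(x\otimes\mathbf 1_{t/r})$ (ordinary matrix-vector product on the right). $x\leftrightarrow y$ means $x\otimes\mathbf 1_\alpha=y\otimes\mathbf 1_\beta$ for some positive integers $\alpha,\beta$; $\bar x$ is the class of $x$. $A\approx B$ means $A\otimes J_\alpha=B\otimes J_\beta$ for some positive integers $\alpha,\beta$; $\hat A$ is the class of $A$. Both are equivalence relations. *)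

(* Defs.v *)
From HB Require Import structures.
From mathcomp Require Import all_boot all_order all_algebra.
From mathcomp Require Import generic_quotient character.
From mathcomp Require Import boolp reals.

Set Implicit Arguments.
Unset Strict Implicit.
Unset Printing Implicit Defensive.

Import GRing.Theory.
Local Open Scope ring_scope.

(* The Kronecker product is MathComp's [tprod]: [tprod A B] is the block matrix
   whose (i, j) block is [A i j *: B]. *)
Notation "A *t B" := (tprod A B) (at level 40, left associativity) : ring_scope.

Section Objects.
Variable R : realType.

(* Equality of [Tagged] vectors (resp. matrices) means equality of the sizes
   together with equality of the entries. *)
Definition anyvec := {n : nat & 'cV[R]_n}.
Definition anymat := {d : nat * nat & 'M[R]_(d.1, d.2)}.

Definition mkvec n (x : 'cV[R]_n) : anyvec := Tagged (fun n => 'cV[R]_n) x.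
Definition mkmat m n (A : 'M[R]_(m, n)) : anymat :=
  @Tagged _ (m, n) (fun d : nat * nat => 'M[R]_(d.1, d.2)) A.

Definition Vspace := {x : anyvec | (0 < tag x)%N}.
Definition Mspace := {A : anymat | (0 < (tag A).1)%N && (0 < (tag A).2)%N}.
HB.instance Definition _ := Choice.on Vspace.
HB.instance Definition _ := Choice.on Mspace.

Definition vdim (x : Vspace) : nat := tag (val x).
Definition vval (x : Vspace) : 'cV[R]_(vdim x) := tagged (val x).
Definition nrows (A : Mspace) : nat := (tag (val A)).1.
Definition ncols (A : Mspace) : nat := (tag (val A)).2.
Definition mval (A : Mspace) : 'M[R]_(nrows A, ncols A) := tagged (val A).

Definition ones k : 'cV[R]_k := const_mx 1.
Definition Jmat k : 'M[R]_k := k%:R^-1 *: const_mx 1.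

(* The type ascription uses that [1 * 1] computes to [1]. *)
Definition vtens n (x : 'cV[R]_n) k : 'cV[R]_(n * k) := x *t ones k.

Definition vequiv (x y : Vspace) : Prop :=
  exists a b : nat, [/\ (0 < a)%N, (0 < b)%N &
    mkvec (vtens (vval x) a) = mkvec (vtens (vval y) b)].

Definition mequiv (A B : Mspace) : Prop :=
  exists a b : nat, [/\ (0 < a)%N, (0 < b)%N &
    mkmat (mval A *t Jmat a) = mkmat (mval B *t Jmat b)].

Lemma lcm_dims n r : (r * (lcmn n r %/ r) = n * (lcmn n r %/ n))%N.
Proof. by rewrite ![(_ * (_ %/ _))%N]mulnC !divnK ?dvdn_lcml ?dvdn_lcmr. Qed.

(* Both factors have inner size [lcmn n r], written as [n * (t %/ n)] on the
   left and [r * (t %/ r)] on the right; [castmx] only identifies the two. *)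
Definition stp m n r (A : 'M[R]_(m, n)) (x : 'cV[R]_r) :
    'cV[R]_(m * (lcmn n r %/ n)) :=
  (A *t Jmat (lcmn n r %/ n)) *m
  castmx (lcm_dims n r, erefl 1%N) (vtens x (lcmn n r %/ r)).

Lemma stp_subproof (A : Mspace) (x : Vspace) :
  (0 < tag (mkvec (stp (mval A) (vval x))))%N.
Proof.
have /andP[m0 n0] : (0 < nrows A)%N && (0 < ncols A)%N := valP A.
have r0 : (0 < vdim x)%N := valP x.
by rewrite /= muln_gt0 m0 divn_gt0 // dvdn_leq ?dvdn_lcml // lcmn_gt0 n0.
Qed.

Definition mvact (A : Mspace) (x : Vspace) : Vspace :=
  exist (fun y : anyvec => (0 < tag y)%N) _ (stp_subproof A x).

End Objects.

Section Equivalences.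
Variable R : realType.

(* Entries indexed by natural numbers, zero out of range: this turns equality
   of tagged matrices into equality of sizes and of functions. *)
Definition entry m n (A : 'M[R]_(m, n)) (i j : nat) : R :=
  if insub i is Some i' then (if insub j is Some j' then A i' j' else 0) else 0.

Lemma entryE m n (A : 'M[R]_(m, n)) (i : 'I_m) (j : 'I_n) : entry A i j = A i j.
Proof. by rewrite /entry !valK. Qed.

Lemma entry_outl m n (A : 'M[R]_(m, n)) i j : (m <= i)%N -> entry A i j = 0.
Proof. by move=> mi; rewrite /entry insubF // ltnNge mi. Qed.

Lemma entry_outr m n (A : 'M[R]_(m, n)) i j : (n <= j)%N -> entry A i j = 0.
Proof.
by move=> nj; rewrite /entry; case: insub => // i'; rewrite insubF // ltnNge nj.
Qed.

Lemma entry_const m n (c : R) i j :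
  entry (const_mx c : 'M_(m, n)) i j = if (i < m)%N && (j < n)%N then c else 0.
Proof.
case: (ltnP i m) => [im|/entry_outl->//] /=.
case: (ltnP j n) => [jn|/entry_outr->//] /=.
by rewrite (entryE _ (Ordinal im) (Ordinal jn)) mxE.
Qed.

Lemma entryZ m n (c : R) (A : 'M[R]_(m, n)) i j :
  entry (c *: A) i j = c * entry A i j.
Proof.
case: (ltnP i m) => [im|mi]; last by rewrite !entry_outl ?mulr0.
case: (ltnP j n) => [jn|nj]; last by rewrite !entry_outr ?mulr0.
by rewrite !(entryE _ (Ordinal im) (Ordinal jn)) mxE.
Qed.

Lemma entry_Jmat k i j : entry (Jmat R k) i j =
  if (i < k)%N && (j < k)%N then k%:R^-1 else 0.
Proof. by rewrite entryZ entry_const; case: ifP; rewrite ?mulr1 ?mulr0. Qed.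

Lemma entry_row_mx m n1 n2 (A : 'M[R]_(m, n1)) (B : 'M[R]_(m, n2)) i j :
  entry (row_mx A B) i j =
  if (j < n1)%N then entry A i j else entry B i (j - n1)%N.
Proof.
case: (ltnP i m) => [im|mi]; last by rewrite !entry_outl // if_same.
case: ltnP => [jn|nj].
  have -> : j = lshift n2 (Ordinal jn) by [].
  by rewrite (entryE _ (Ordinal im)) row_mxEl -entryE.
case: (ltnP j (n1 + n2)) => [jn|nj']; last first.
  by rewrite !entry_outr // leq_subRL.
have jn2 : (j - n1 < n2)%N by rewrite ltn_subLR.
have {1}-> : j = rshift n1 (Ordinal jn2) by rewrite /= subnKC.
by rewrite (entryE _ (Ordinal im)) row_mxEr -entryE.
Qed.

Lemma entry_tr m n (A : 'M[R]_(m, n)) i j : entry A^T i j = entry A j i.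
Proof.
case: (ltnP i n) => [im|mi]; last by rewrite entry_outl // entry_outr.
case: (ltnP j m) => [jn|nj]; last by rewrite entry_outr // entry_outl.
by rewrite (entryE _ (Ordinal im) (Ordinal jn)) mxE -entryE.
Qed.

Lemma entry_col_mx m1 m2 n (A : 'M[R]_(m1, n)) (B : 'M[R]_(m2, n)) i j :
  entry (col_mx A B) i j =
  if (i < m1)%N then entry A i j else entry B (i - m1)%N j.
Proof. by rewrite -entry_tr tr_col_mx entry_row_mx !entry_tr. Qed.

Lemma entry_lsubmx m n1 n2 (A : 'M[R]_(m, n1 + n2)) i j : (j < n1)%N ->
  entry (lsubmx A) i j = entry A i j.
Proof. by move=> jn; rewrite -{2}[A]hsubmxK entry_row_mx jn. Qed.

Lemma entry_rsubmx m n1 n2 (A : 'M[R]_(m, n1 + n2)) i j :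
  entry (rsubmx A) i j = entry A i (n1 + j)%N.
Proof.
by rewrite -{2}[A]hsubmxK entry_row_mx ltnNge leq_addr /= addKn.
Qed.

Lemma entry_usubmx m1 m2 n (A : 'M[R]_(m1 + m2, n)) i j : (i < m1)%N ->
  entry (usubmx A) i j = entry A i j.
Proof. by move=> im; rewrite -{2}[A]vsubmxK entry_col_mx im. Qed.

Lemma entry_dsubmx m1 m2 n (A : 'M[R]_(m1 + m2, n)) i j :
  entry (dsubmx A) i j = entry A (m1 + i)%N j.
Proof.
by rewrite -{2}[A]vsubmxK entry_col_mx ltnNge leq_addr /= addKn.
Qed.

Lemma entry_trow n1 (A : 'rV[R]_n1) m2 n2 (B : 'M[R]_(m2, n2)) i j :
  (0 < n2)%N ->
  entry (trow A B) i j = entry A 0 (j %/ n2) * entry B i (j %% n2).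
Proof.
move=> n2_gt0; elim: n1 A j => [|n1 IH] A j /=.
  by rewrite entry_outr // (@entry_outr _ _ A) // mul0r.
rewrite (@entry_row_mx m2 n2 (n1 * n2)) entryZ IH.
rewrite (@entry_rsubmx 1 1 n1 A).
case: ltnP => [jn|nj].
  rewrite divn_small // modn_small //; congr (_ * _).
  rewrite -(entryE (lsubmx (A : 'M_(1, 1 + n1)))) /=.
  exact: (@entry_lsubmx 1 1 n1 A).
rewrite -{3 4}(subnK nj) modnDr divnDr ?dvdnn // divnn n2_gt0.
by rewrite (addnC 1%N (_ %/ _)%N).
Qed.

Lemma entry_tprod m1 n1 (A : 'M[R]_(m1, n1)) m2 n2 (B : 'M[R]_(m2, n2)) i j :
  (0 < m2)%N -> (0 < n2)%N ->
  entry (A *t B) i j =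
  entry A (i %/ m2) (j %/ n2) * entry B (i %% m2) (j %% n2).
Proof.
move=> m2_gt0 n2_gt0; elim: m1 A i => [|m1 IH] A i /=.
  by rewrite entry_outl // (@entry_outl _ _ A) // mul0r.
rewrite (@entry_col_mx m2 (m1 * m2)) IH entry_trow //.
rewrite (@entry_dsubmx 1 m1 n1 A).
case: ltnP => [im|mi].
  rewrite (divn_small im) (modn_small im); congr (_ * _).
  exact: (@entry_usubmx 1 m1 n1 A).
rewrite -{3 4}(subnK mi) modnDr divnDr ?dvdnn // divnn m2_gt0.
by rewrite (addnC 1%N (_ %/ _)%N).
Qed.

Lemma mkvecP m n (x : 'cV[R]_m) (y : 'cV[R]_n) :
  mkvec x = mkvec y <-> m = n /\ forall i j, entry x i j = entry y i j.
Proof.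
split=> [xy|[mn]]; last first.
  rewrite -{}mn in y *.
  by move=> xy; congr mkvec; apply/matrixP => i j; rewrite -!entryE.
have mn : m = n := congr1 tag xy; split=> // i j.
exact: (congr1 (fun z : anyvec R => entry (tagged z) i j) xy).
Qed.

Lemma mkmatP m n p q (A : 'M[R]_(m, n)) (B : 'M[R]_(p, q)) :
  mkmat A = mkmat B <->
  [/\ m = p, n = q & forall i j, entry A i j = entry B i j].
Proof.
split=> [AB|[mp nq]]; last first.
  rewrite -{}mp -{}nq in B *.
  by move=> AB; congr mkmat; apply/matrixP => i j; rewrite -!entryE.
have [mp nq] : (m, n) = (p, q) := congr1 tag AB; split=> // i j.
exact: (congr1 (fun z : anymat R => entry (tagged z) i j) AB).
Qed.

Lemma divn_modn_mul i a b : ((i %/ b) %% a = (i %% (a * b)) %/ b)%N.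
Proof. by rewrite -modn_divl. Qed.

Lemma tprodA_entry m1 n1 (A : 'M[R]_(m1, n1)) m2 n2 (B : 'M[R]_(m2, n2))
    m3 n3 (C : 'M[R]_(m3, n3)) i j :
  (0 < m2)%N -> (0 < n2)%N -> (0 < m3)%N -> (0 < n3)%N ->
  entry (A *t B *t C) i j = entry (A *t (B *t C)) i j.
Proof.
move=> m20 n20 m30 n30; rewrite !entry_tprod ?muln_gt0 ?m20 ?n20 //.
rewrite -!divnMA !divn_modn_mul !(@modn_dvdm (_ * _)) ?dvdn_mull //.
by rewrite mulrA ![(m3 * _)%N]mulnC ![(n3 * _)%N]mulnC.
Qed.

Lemma ones_tens a b : (0 < b)%N -> vtens (ones R a) b = ones R (a * b).
Proof.
move=> b0; apply/matrixP => i j.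
rewrite -!entryE /vtens (@entry_tprod a 1 _ b 1) // !entry_const !ltn_mod b0 /=.
by rewrite ltn_divLR // !ltn_ord /= !ord1 divn1 mulr1.
Qed.

Lemma Jmat_tens a b : (0 < b)%N -> Jmat R a *t Jmat R b = Jmat R (a * b).
Proof.
move=> b0; apply/matrixP => i j.
rewrite -!entryE entry_tprod // !entry_Jmat !ltn_mod b0 /=.
by rewrite !ltn_divLR // !ltn_ord /= natrM invfM.
Qed.

Lemma vtensA n (x : 'cV[R]_n) a b : (0 < a)%N -> (0 < b)%N ->
  mkvec (vtens (vtens x a) b) = mkvec (vtens x (a * b)).
Proof.
move=> a0 b0; apply/mkvecP; split=> [|i j]; first by rewrite mulnA.
by rewrite /vtens (@tprodA_entry n 1 x a 1 _ b 1) // -ones_tens.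
Qed.

Lemma mtensA m n (A : 'M[R]_(m, n)) a b : (0 < a)%N -> (0 < b)%N ->
  mkmat (A *t Jmat R a *t Jmat R b) = mkmat (A *t Jmat R (a * b)).
Proof.
move=> a0 b0; apply/mkmatP; split=> [||i j]; rewrite ?mulnA //.
by rewrite tprodA_entry // Jmat_tens.
Qed.

Lemma mkvec_tens m n (x : 'cV[R]_m) (y : 'cV[R]_n) k :
  mkvec x = mkvec y -> mkvec (vtens x k) = mkvec (vtens y k).
Proof. by move/(congr1 (fun z : anyvec R => mkvec (vtens (tagged z) k))). Qed.

Lemma mkmat_tens m n p q (A : 'M[R]_(m, n)) (B : 'M[R]_(p, q)) k :
  mkmat A = mkmat B -> mkmat (A *t Jmat R k) = mkmat (B *t Jmat R k).
Proof.
by move/(congr1 (fun z : anymat R => mkmat (tagged z *t Jmat R k))).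
Qed.

Lemma vequiv_refl (x : Vspace R) : vequiv x x.
Proof. by exists 1%N, 1%N. Qed.

Lemma vequiv_sym (x y : Vspace R) : vequiv x y -> vequiv y x.
Proof. by move=> [a [b [a0 b0 xy]]]; exists b, a. Qed.

Lemma vequiv_trans (y x z : Vspace R) : vequiv x y -> vequiv y z -> vequiv x z.
Proof.
move=> [a [b [a0 b0 xy]]] [c [d [c0 d0 yz]]].
exists (a * c)%N, (d * b)%N; split; rewrite ?muln_gt0 ?a0 ?d0 //.
rewrite -!vtensA // (mkvec_tens _ xy) -(mkvec_tens _ yz).
by rewrite !vtensA // (mulnC b)%N.
Qed.

Lemma mequiv_refl (A : Mspace R) : mequiv A A.
Proof. by exists 1%N, 1%N. Qed.

Lemma mequiv_sym (A B : Mspace R) : mequiv A B -> mequiv B A.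
Proof. by move=> [a [b [a0 b0 AB]]]; exists b, a. Qed.

Lemma mequiv_trans (B A C : Mspace R) : mequiv A B -> mequiv B C -> mequiv A C.
Proof.
move=> [a [b [a0 b0 AB]]] [c [d [c0 d0 BC]]].
exists (a * c)%N, (d * b)%N; split; rewrite ?muln_gt0 ?a0 ?d0 //.
rewrite -!mtensA // (mkmat_tens _ AB) -(mkmat_tens _ BC).
by rewrite !mtensA // (mulnC b)%N.
Qed.

Definition vequivb : rel (Vspace R) := fun x y => `[< vequiv x y >].
Definition mequivb : rel (Mspace R) := fun A B => `[< mequiv A B >].

Lemma vequivb_refl : reflexive vequivb.
Proof. by move=> x; apply/asboolP; exact: vequiv_refl. Qed.
Lemma vequivb_sym : symmetric vequivb.
Proof. by move=> x y; apply/asboolP/asboolP; exact: vequiv_sym. Qed.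
Lemma vequivb_trans : transitive vequivb.
Proof.
by move=> y x z /asboolP xy /asboolP yz; apply/asboolP; exact: vequiv_trans yz.
Qed.

Lemma mequivb_refl : reflexive mequivb.
Proof. by move=> A; apply/asboolP; exact: mequiv_refl. Qed.
Lemma mequivb_sym : symmetric mequivb.
Proof. by move=> A B; apply/asboolP/asboolP; exact: mequiv_sym. Qed.
Lemma mequivb_trans : transitive mequivb.
Proof.
by move=> B A C /asboolP AB /asboolP BC; apply/asboolP; exact: mequiv_trans BC.
Qed.

Canonical vequiv_rel := EquivRel vequivb vequivb_refl vequivb_sym vequivb_trans.
Canonical mequiv_rel := EquivRel mequivb mequivb_refl mequivb_sym mequivb_trans.

Definition Omega := {eq_quot vequiv_rel}%qT.
Definition Xi := {eq_quot mequiv_rel}%qT.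

Definition vclass (x : Vspace R) : Omega := (\pi_Omega x)%qT.
Definition mclass (A : Mspace R) : Xi := (\pi_Xi A)%qT.

End Equivalences.

(* Main.v *)
(** The product [(A (x) J_s) (x (x) 1_u)] with [n s = r u] does not depend, up
    to equivalence, on the common multiple [n s = r u]: refining it by a factor
    [k] tensors the result with [J_k 1_k = 1_k].  If [A (x) J_a = B (x) J_b] and
    [x (x) 1_c = y (x) 1_d], then at a common multiple of all the sizes
    involved both products are formed from the same matrix and vector. *)
Require Import Defs.
From mathcomp Require Import all_boot all_order all_algebra.
From mathcomp Require Import generic_quotient character boolp reals.
From mathcomp Require Import ring.

Set Implicit Arguments.
Unset Strict Implicit.
Unset Printing Implicit Defensive.

Import GRing.Theory.
Local Open Scope ring_scope.

Section Action.
Variable R : realType.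

(* Total in the sizes, so that equalities of tagged matrices and vectors can be
   rewritten in it without casts. *)
Definition anymul (A : anymat R) (x : anyvec R) : anyvec R :=
  mkvec (\col_(i < (tag A).1)
    \sum_(k < (tag A).2) tagged A i k * entry (tagged x) k 0).

Lemma anymul_mulmx m n (A : 'M[R]_(m, n)) (x : 'cV[R]_n) :
  anymul (mkmat A) (mkvec x) = mkvec (A *m x).
Proof.
congr mkvec; apply/matrixP => i j; rewrite !mxE; apply: eq_bigr => k _ /=.
by rewrite (ord1 j) -(entryE x k ord0).
Qed.

Lemma mkvec_castmx n n' (e : n = n') (x : 'cV[R]_n) :
  mkvec (castmx (e, erefl 1%N) x) = mkvec x.
Proof. by case: n' / e; rewrite castmx_id. Qed.

Lemma mkvec_stp m n r (A : 'M[R]_(m, n)) (x : 'cV[R]_r) :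
  mkvec (stp A x) = anymul (mkmat (A *t Jmat R (lcmn n r %/ n)))
                           (mkvec (vtens x (lcmn n r %/ r))).
Proof. by rewrite -(mkvec_castmx (lcm_dims n r)) anymul_mulmx. Qed.

Lemma Jmat_ones k : (0 < k)%N -> Jmat R k *m ones R k = ones R k.
Proof.
move=> k0; apply/matrixP => i j; rewrite !mxE.
under eq_bigr do rewrite !mxE !mulr1.
rewrite sumr_const card_ord -[_ *+ k]mulr_natl mulfV //.
by rewrite Num.Theory.pnatr_eq0 -lt0n.
Qed.

(** The mixed-product rule for Kronecker products, with [Jmat_ones] absorbing the second factor. *)
Lemma mulmx_tens m n (A : 'M[R]_(m, n)) (x : 'cV[R]_n) k : (0 < k)%N ->
  (A *t Jmat R k) *m vtens x k = vtens (A *m x) k.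
Proof.
move=> k0; rewrite /vtens -{2}(Jmat_ones k0).
by rewrite [RHS](tprodE A x (Jmat R k) (ones R k)).
Qed.

(** Restates [mulmx_tens] for inner sizes that are only provably equal, as are the two expressions
    of the lcm in [stp]. *)
Lemma anymul_tens m n r (A : 'M[R]_(m, n)) (x : 'cV[R]_r) k :
  (0 < k)%N -> n = r ->
  anymul (mkmat (A *t Jmat R k)) (mkvec (vtens x k)) =
  mkvec (vtens (tagged (anymul (mkmat A) (mkvec x))) k).
Proof.
move=> k0 nr; case: r / nr x => x.
by rewrite anymul_mulmx mulmx_tens // anymul_mulmx.
Qed.

Lemma lcmn_divl_gt0 n r : (0 < n)%N -> (0 < r)%N -> (0 < lcmn n r %/ n)%N.
Proof.
by move=> n0 r0; rewrite divn_gt0 // dvdn_leq ?dvdn_lcml // lcmn_gt0 n0.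
Qed.

Lemma stp_tens m n r (A : 'M[R]_(m, n)) (x : 'cV[R]_r) k :
  (0 < n)%N -> (0 < r)%N -> (0 < k)%N ->
  mkvec (vtens (stp A x) k) = anymul (mkmat (A *t Jmat R (lcmn n r %/ n * k)))
                                     (mkvec (vtens x (lcmn n r %/ r * k))).
Proof.
move=> n0 r0 k0.
have s0 := lcmn_divl_gt0 n0 r0.
have u0 : (0 < lcmn n r %/ r)%N by rewrite lcmnC lcmn_divl_gt0.
by rewrite -mtensA // -vtensA // anymul_tens ?lcm_dims // -mkvec_stp.
Qed.

Lemma common_refinement n r p q a b c d s u s' u' :
  (0 < n * s)%N -> (0 < p * s')%N -> (0 < n * a)%N -> (0 < r * c)%N ->
  (n * a = p * b -> r * c = q * d -> r * u = n * s -> q * u' = p * s' ->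
  exists k k' e f, [/\ [/\ (0 < k)%N, (0 < k')%N, (0 < e)%N & (0 < f)%N],
    s * k = a * e, u * k = c * f, s' * k' = b * e & u' * k' = d * f])%N.
Proof.
move=> ns0 ps0 na0 rc0 na rc ns ps.
(* The common inner size is the product of [n * a], [r * c], [n * s] and [p * s']; each witness
   omits one of these four factors. In the last one [n * s] is written [r * u], to match [u * k]. *)
exists (n * a * (r * c) * (p * s'))%N, (n * a * (r * c) * (n * s))%N.
exists (n * s * (r * c) * (p * s'))%N, (r * u * (n * a) * (p * s'))%N.
split.
- move: ns0 ps0 na0 rc0; rewrite ns !muln_gt0.
  by move=> /andP[-> ->] /andP[-> ->] /andP[_ ->] /andP[-> ->].
- by ring.
- by ring.
- by rewrite na; ring.
- by rewrite rc -ps -ns; ring.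
Qed.

Lemma vequiv_mvact (A B : Mspace R) (x y : Vspace R) :
  mequiv A B -> vequiv x y -> vequiv (mvact A x) (mvact B y).
Proof.
move=> [a [b [a0 b0 AB]]] [c [d [c0 d0 xy]]].
have /andP[_ n0] : (0 < nrows A)%N && (0 < ncols A)%N := valP A.
have /andP[_ p0] : (0 < nrows B)%N && (0 < ncols B)%N := valP B.
have r0 : (0 < vdim x)%N := valP x.
have q0 : (0 < vdim y)%N := valP y.
have [_ na _] := (mkmatP _ _).1 AB; have [rc _] := (mkvecP _ _).1 xy.
have s0 := lcmn_divl_gt0 n0 r0; have s0' := lcmn_divl_gt0 p0 q0.
have [||||k [k' [e [f [[k0 k0' e0 f0] sk uk sk' uk']]]]] :=
  common_refinement _ _ _ _ na rc (lcm_dims _ _) (lcm_dims _ _);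
  rewrite ?muln_gt0 ?n0 ?p0 ?r0 //.
exists k, k'; split=> //.
(* Regrouping exposes the two sides of [AB] tensored with [Jmat R e], and those of [xy] tensored
   with [ones R f]. *)
rewrite !stp_tens // sk uk sk' uk' -!mtensA // -!vtensA //.
by rewrite (mkmat_tens e AB) (mkvec_tens f xy).
Qed.

End Action.

Theorem mainTheorem7 (R : realType) :
  (forall (A B : Mspace R) (x y : Vspace R),
      mequiv A B -> vequiv x y -> vequiv (mvact A x) (mvact B y)) /\
  (exists! act : Xi R -> Omega R -> Omega R,
      forall (A : Mspace R) (x : Vspace R),
        act (mclass A) (vclass x) = vclass (mvact A x)).
Proof.
have act_wd := @vequiv_mvact R; split=> //.
(* Act through chosen representatives; [act_wd] makes the choice immaterial. *)
exists (fun a o => vclass (mvact (repr a) (repr o))); split.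
  move=> A x; apply/eqmodP/asboolP/act_wd.
  - by apply/asboolP/(@eqmodP _ (mequiv_rel R)); rewrite reprK.
  - by apply/asboolP/(@eqmodP _ (vequiv_rel R)); rewrite reprK.
(* Uniqueness: every class is the class of its representative, so [actE] fixes all values. *)
move=> act actE; apply/funext => a; apply/funext => o.
by rewrite -actE /mclass /vclass !reprK.
Qed.
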